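(* Let $N$ be a finite set and $f: 2^{N} \to \mathbb{R} \cup \{-\infty\}$ an M$^\natural$-concave function. For any $X, Y \in \arg\max f$ and any $I \subseteq X \setminus Y$, there exists $J \subseteq Y \setminus X$ such that $(X \setminus I) \cup J \in \arg\max f$ and $(Y \setminus J) \cup I \in \arg\max f$.
   Context: $\arg\max f$ denotes the set of maximizers of $f$ over $2^N$. For $f: 2^N \to \mathbb{R}\cup\{-\infty\}$, $\mathrm{dom}\, f = \{X \subseteq N : f(X) > -\infty\}$. Notation: $X - i = X \setminus \{i\}$, $Y + i = Y \cup \{i\}$, $X - i + j = (X\setminus\{i\})\cup\{j\}$, $Y + i - j = (Y \cup\{i\})\setminus\{j\}$. Conventions: $(-\infty)+a = a+(-\infty) = (-\infty)+(-\infty) = -\infty$ for $a \in \mathbb{R}$, $-\infty \le -\infty$, and a maximum over an empty set is $-\infty$. A function $f: 2^N \to \mathbb{R}\cup\{-\infty\}$ with $\mathrm{dom}\, f \neq \emptyset$ is M$^\natural$-concave if for all $X, Y \subseteq N$ and $i \in X \setminus Y$: $$f(X)+f(Y) \le \max\Big[ f(X-i)+f(Y+i),\ \max_{j \in Y\setminus X}\{ f(X-i+j)+f(Y+i-j)\}\Big].$$ *)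

(* Defs.v *)
(* Values in R ∪ {-∞} are modelled as [option R],
   with [None] = -∞, for an arbitrary real domain R (covers the reals). *)
From HB Require Import structures.
From mathcomp Require Import all_boot all_order all_algebra.
Set Implicit Arguments. Unset Strict Implicit. Unset Printing Implicit Defensive.
Import Order.TTheory GRing.Theory Num.Theory.
Local Open Scope ring_scope.

Section ExtReal.
Variable R : realDomainType.

Definition eadd (a b : option R) : option R :=
  match a, b with Some x, Some y => Some (x + y) | _, _ => None end.

Definition ele (a b : option R) : bool :=
  match a, b with
  | None, _ => true
  | Some _, None => false
  | Some x, Some y => x <= y
  end.

Definition emax (a b : option R) : option R := if ele a b then b else a.

Variable N : finType.

Definition dom (f : {set N} -> option R) : {set {set N}} :=
  [set X | f X != None].

Definition Mnat_concave (f : {set N} -> option R) : Prop :=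
  dom f != set0 /\
  forall (X Y : {set N}) (i : N), i \in X :\: Y ->
    ele (eadd (f X) (f Y))
        (emax (eadd (f (X :\ i)) (f (i |: Y)))
              (\big[emax/None]_(j in Y :\: X)
                  eadd (f (j |: (X :\ i))) (f ((i |: Y) :\ j)))).

Definition in_argmax (f : {set N} -> option R) (X : {set N}) : Prop :=
  forall Z : {set N}, ele (f Z) (f X).

End ExtReal.

(* Main.v *)
(** The maximizers of [f] form a generalized matroid. Padding them with dummy
    elements up to the common size [#|N|] yields the bases of a matroid, so it
    is enough to prove the multiple symmetric exchange property for matroid
    bases [X], [Y]. There, with [r] the rank function, one looks for
    [J \subset Y :\: X] such that both [r ((X :\: I) :|: J)] and
    [r ((Y :\: J) :|: I)] are full. The elements of [Y :\: X] are put into [J]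
    or outside [J] one at a time; submodularity of [r] shows that at least one
    of the two choices preserves the Hall-type inequality
    [#|Z| + c <= r (Z :|: (X :\: I)) + r (Z :|: (I :|: X :&: Y))], which itself
    is an instance of submodularity. *)
Require Import Defs.
From HB Require Import structures.
From mathcomp Require Import all_boot all_order all_algebra.
From mathcomp Require Import zify.
Set Implicit Arguments. Unset Strict Implicit. Unset Printing Implicit Defensive.
Import Order.TTheory GRing.Theory Num.Theory.

(** * Submodular set functions and a Hall-type partition lemma *)

Definition submodular (T : finType) (g : {set T} -> nat) :=
  forall A B : {set T}, g (A :|: B) + g (A :&: B) <= g A + g B.

Lemma submodular_setU (T : finType) (g : {set T} -> nat) (C : {set T}) :
  submodular g -> submodular (fun Z => g (Z :|: C)).
Proof.
by move=> gS A B; have := gS (A :|: C) (B :|: C); rewrite -setUIl -setUUl.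
Qed.

Lemma submodular_partition (T : finType) (g1 g2 : {set T} -> nat)
    (U : {set T}) (c : nat) :
  submodular g1 -> submodular g2 ->
  (forall Z : {set T}, Z \subset U -> #|Z| + c <= g1 Z + g2 Z) ->
  exists2 J : {set T}, J \subset U & #|U| + c <= g1 J + g2 (U :\: J).
Proof.
have [k] := ubnP #|U|; elim: k => // k IHk in g1 g2 U c *.
move=> leUk g1S g2S hall.
have [U0 | [y yU]] := set_0Vmem U.
  by exists set0; rewrite ?sub0set // U0 set0D; apply: hall; rewrite sub0set.
pose V := U :\ y; have yV : y \notin V by rewrite !inE eqxx.
have cU : #|U| = #|V|.+1 by rewrite (cardsD1 y) yU.
have ltVk : #|V| < k by move: leUk; rewrite cU ltnS.
have subV (Z : {set T}) : Z \subset V -> y |: Z \subset U /\ y \notin Z.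
  move=> sZV; split; last by apply: contra yV; apply: (subsetP sZV).
  by rewrite subUset sub1set yU (subset_trans sZV) ?subsetDl.
(* Try [y] in [J]: [g1] absorbs [y], and [c] grows by one because [#|U| + c = #|V| + c.+1]. *)
case: (boolP [forall Z : {set T},
    (Z \subset V) ==> (#|Z| + c.+1 <= g1 (Z :|: [set y]) + g2 Z)]).
  move=> /forallP hall1.
  have [|J sJV le_J] := IHk _ g2 V c.+1 ltVk (submodular_setU [set y] g1S) g2S.
    by move=> Z sZV; have := hall1 Z; rewrite sZV.
  have [sJU _] := subV J sJV.
  exists (y |: J); rewrite // -setDDl setUC.
  by rewrite cU addSnnS.
rewrite negb_forall => /existsP[Z]; rewrite negb_imply -ltnNge => /andP[sZV ltZ].
case: (boolP [forall W : {set T},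
    (W \subset V) ==> (#|W| + c.+1 <= g1 W + g2 (W :|: [set y]))]).
  move=> /forallP hall2.
  have [|J sJV le_J] := IHk g1 _ V c.+1 ltVk g1S (submodular_setU [set y] g2S).
    by move=> W sWV; have := hall2 W; rewrite sWV.
  have [sJU yJ] := subV J sJV.
  exists J; first by rewrite (subset_trans sJV) ?subsetDl.
  have -> : U :\: J = (V :\: J) :|: [set y].
    apply/setP=> x; rewrite !inE; have [->|] := eqVneq x y; last by rewrite orbF.
    by rewrite yU yJ orbT.
  by rewrite cU addSnnS.
rewrite negb_forall => /existsP[W]; rewrite negb_imply -ltnNge => /andP[sWV ltW].
(* Both choices fail, at [Z] and at [W]. Submodularity then bounds the sum of the [hall] right-hand
   sides at [y |: (Z :|: W)] and [Z :&: W] by [#|Z| + #|W| + 2c], while [hall] demands one more, on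
   account of [y]. *)
have [sZU yZ] := subV Z sZV; have [sWU yW] := subV W sWV.
have sub_U : y |: (Z :|: W) \subset U.
  by have [] := subV (Z :|: W); rewrite // subUset sZV.
have sub_I : Z :&: W \subset U.
  exact: subset_trans (subset_trans (subsetIl _ _) sZV) (subsetDl _ _).
have := hall _ sub_U; have := hall _ sub_I.
have := g1S (Z :|: [set y]) W; have := g2S Z (W :|: [set y]).
have -> : (Z :|: [set y]) :&: W = Z :&: W.
  by apply/setP=> x; rewrite !inE; case: eqVneq => [->|]; rewrite ?(negPf yW) ?andbF ?orbF.
have -> : Z :&: (W :|: [set y]) = Z :&: W.
  by apply/setP=> x; rewrite !inE; case: eqVneq => [->|]; rewrite ?(negPf yZ) ?andbF ?orbF.
rewrite setUAC setUA [Z :|: W :|: _]setUC cardsU1 !inE negb_or yZ yW /=.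
by have := cardsUI Z W; lia.
Qed.

(** * The rank function of a matroid given by its bases *)

Definition basis_exchange (T : finType) (B : pred {set T}) :=
  forall (X Y : {set T}) (i : T), B X -> B Y -> i \in X :\: Y ->
    exists2 j, j \in Y :\: X & B (j |: (X :\ i)).

Section MatroidBases.

Variables (T : finType) (B : pred {set T}) (n : nat).
Hypothesis card_basis : forall S, B S -> #|S| = n.
Hypothesis exB : basis_exchange B.

Definition basis_rank (Z : {set T}) : nat := \max_(S | B S) #|S :&: Z|.

Lemma leq_basis_rank S (Z : {set T}) : B S -> #|S :&: Z| <= basis_rank Z.
Proof. by move=> BS; exact: (@leq_bigmax_cond _ B (fun S : {set T} => #|S :&: Z|)). Qed.

Lemma basis_rank_witness S0 Z : B S0 -> exists2 S, B S & #|S :&: Z| = basis_rank Z.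
Proof.
move=> BS0; have [|S BS eqS] := @eq_bigmax_cond _ B (fun S : {set T} => #|S :&: Z|).
  by apply/card_gt0P; exists S0.
by exists S; [exact: BS | exact: esym eqS].
Qed.

(** Move a basis [S] optimal for [P] towards a basis [S'] optimal for [Q]. If [S] falls short on
    [Q], equal cardinalities give [i] in [S] outside both [Q] and [S']; exchanging it for an element
    of [S'] loses nothing on [P], since [P \subset Q]. *)
Lemma basis_rank_chain S0 (P Q : {set T}) : B S0 -> P \subset Q ->
  exists S, [/\ B S, #|S :&: P| = basis_rank P & #|S :&: Q| = basis_rank Q].
Proof.
move=> BS0 sPQ.
have [S BS SP] := basis_rank_witness P BS0.
have [S' BS' S'Q] := basis_rank_witness Q BS0.
have [k] := ubnP #|S :\: S'|; elim: k => // k IHk in S BS SP *; rewrite ltnS => leSk.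
have leSQ := leq_basis_rank Q BS.
case: (eqVneq #|S :&: Q| (basis_rank Q)) => [SQ|neSQ]; first by exists S.
have [i] : exists i, i \in (S :\: Q) :\: S'.
  apply/set0Pn; rewrite setD_eq0; apply: contraNN neSQ => sSS'.
  have : #|S :\: Q| <= #|S' :\: Q|.
    apply: subset_leq_card; apply/subsetP=> x xSQ; rewrite inE (subsetP sSS') // andbT.
    by move: xSQ; rewrite inE => /andP[].
  have := cardsID Q S; have := cardsID Q S'.
  by rewrite (card_basis BS) (card_basis BS'); lia.
rewrite !inE => /and3P[iS' iQ iS].
have [|j] := exB BS BS' (i := i); first by rewrite inE iS'.
rewrite inE => /andP[jS jS'] BSij.
apply: (IHk (j |: (S :\ i))) => //.
  apply/eqP; rewrite eqn_leq leq_basis_rank //= -SP; apply: subset_leq_card.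
  apply/subsetP=> x; rewrite !inE => /andP[xS xP]; rewrite xS xP !andbT.
  apply/orP; right; apply: contraNneq iQ => <-; exact: subsetP xP.
apply: leq_trans leSk; apply: proper_card; apply/properP; split.
  apply/subsetP=> x; rewrite !inE => /andP[xS' /orP[/eqP xj|/andP[_ xS]]].
    by rewrite xj jS' in xS'.
  by rewrite xS'.
exists i; rewrite !inE ?iS' ?eqxx ?orbF //=.
by apply: contraNneq iS' => ->.
Qed.

(** A single basis [S] optimal for both [P :&: Q] and [P :|: Q] reduces the claim to the modularity
    of [#|S :&: _|]. *)
Lemma basis_rank_submodular : submodular basis_rank.
Proof.
move=> P Q; have [S0 BS0 | B0] := pickP B; last first.
  by rewrite /basis_rank !big_pred0.
have [|S [BS SI SU]] := @basis_rank_chain S0 (P :&: Q) (P :|: Q) BS0.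
  by rewrite subIset // subsetUl.
have := leq_basis_rank P BS; have := leq_basis_rank Q BS.
rewrite -SI -SU setIUr setIIr.
by have := cardsUI (S :&: P) (S :&: Q); lia.
Qed.

Lemma basis_of_rank S0 (Z : {set T}) : B S0 -> #|Z| = n -> n <= basis_rank Z -> B Z.
Proof.
move=> BS0 cZ; have [S BS <-] := basis_rank_witness Z BS0 => leZ.
have eqZ : S :&: Z = Z by apply/eqP; rewrite eqEcard subsetIr cZ.
have eqS : S :&: Z = S by apply/eqP; rewrite eqEcard subsetIl (card_basis BS).
by rewrite -eqZ eqS.
Qed.

Lemma basis_rank_le_card (Z : {set T}) : basis_rank Z <= #|Z|.
Proof. by apply/bigmax_leqP=> S _; rewrite subset_leq_card ?subsetIr. Qed.

Lemma basis_rank_le Z : basis_rank Z <= n.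
Proof.
by apply/bigmax_leqP=> S BS; rewrite -(card_basis BS) subset_leq_card ?subsetIl.
Qed.

Lemma basis_multiple_exchange X Y (I : {set T}) : B X -> B Y -> I \subset X :\: Y ->
  exists J : {set T}, [/\ J \subset Y :\: X,
    B ((X :\: I) :|: J) & B ((Y :\: J) :|: I)].
Proof.
move=> BX BY sI.
have sIX : I \subset X by apply: subset_trans sI (subsetDl _ _).
have rankS := basis_rank_submodular.
(* With this constant, [#|Y :\: X| + (#|X| + #|X :&: Y|)] is [n + n], the largest possible sum of
   two ranks. *)
have [|J sJ] := @submodular_partition T
    (fun Z => basis_rank (Z :|: (X :\: I))) (fun Z => basis_rank (Z :|: (I :|: X :&: Y)))
    (Y :\: X) (#|X| + #|X :&: Y|) (submodular_setU _ rankS) (submodular_setU _ rankS).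
  move=> Z sZ; apply: leq_trans (rankS _ _).
  (* The union of the two sets contains the basis [X]; their intersection contains [Z :|: X :&: Y],
     a subset of the basis [Y]. *)
  have rX : #|X| <= basis_rank (Z :|: (X :\: I) :|: (Z :|: (I :|: X :&: Y))).
    apply: leq_trans (leq_basis_rank _ BX); apply: subset_leq_card.
    apply/subsetP=> x xX; rewrite !inE xX /=.
    by case: (x \in I); rewrite ?orbT.
  have rZ : #|Z :|: X :&: Y| <=
      basis_rank ((Z :|: (X :\: I)) :&: (Z :|: (I :|: X :&: Y))).
    apply: leq_trans (leq_basis_rank _ BY); apply: subset_leq_card.
    apply/subsetP=> x; rewrite !inE => /orP[xZ|/andP[xX xY]].
      by have := subsetP sZ x xZ; rewrite inE xZ => /andP[_ ->].
    have -> : x \notin I.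
      by apply/negP=> /(subsetP sI); rewrite inE xY.
    by rewrite xX xY !orbT.
  have := cardsUI Z (X :&: Y).
  have -> : Z :&: (X :&: Y) = set0.
    apply/setP=> x; rewrite !inE; apply/negP=> /and3P[xZ xX _].
    by have := subsetP sZ x xZ; rewrite inE xX.
  by rewrite cards0; lia.
have -> : J :|: (X :\: I) = (X :\: I) :|: J by rewrite setUC.
have -> : (Y :\: X) :\: J :|: (I :|: X :&: Y) = (Y :\: J) :|: I.
  apply/setP=> x; have := subsetP sI x; have := subsetP sJ x; rewrite !inE.
  by case: (x \in I) (x \in J) (x \in X) (x \in Y) => [] [] [] [] //= H1 H2;
    rewrite ?(H1 isT) ?(H2 isT) //; have := H1 isT.
have cX := card_basis BX; have cY := card_basis BY.
have cI1 : #|(X :\: I) :|: J| + #|I| = n + #|J|.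
  have := cardsUI (X :\: I) J; have := cardsID I X; rewrite (setIidPr sIX).
  have -> : (X :\: I) :&: J = set0.
    apply/setP=> x; rewrite !inE; apply/negP=> /andP[/andP[_ xX] /(subsetP sJ)].
    by rewrite inE xX.
  by rewrite cards0; lia.
have sJY : J \subset Y by apply: subset_trans sJ (subsetDl _ _).
have cI2 : #|(Y :\: J) :|: I| + #|J| = n + #|I|.
  have := cardsUI (Y :\: J) I; have := cardsID J Y; rewrite (setIidPr sJY).
  have -> : (Y :\: J) :&: I = set0.
    apply/setP=> x; rewrite !inE; apply/negP=> /andP[/andP[_ xY] /(subsetP sI)].
    by rewrite inE xY.
  by rewrite cards0; lia.
(* Both ranks are at most [n] and sum to at least [n + n], so both are [n]. Hence both cardinalities
   are at least [n]; by [cI1] and [cI2] they sum to [n + n], so they equal [n]. *)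
have := cardsID X Y; rewrite setIC => cXY le_rank.
have le1 := basis_rank_le ((X :\: I) :|: J); have le2 := basis_rank_le ((Y :\: J) :|: I).
have lc1 := basis_rank_le_card ((X :\: I) :|: J).
have lc2 := basis_rank_le_card ((Y :\: J) :|: I).
by exists J; split=> //; apply: basis_of_rank BX _ _; lia.
Qed.

End MatroidBases.

(** * Generalized matroids and their padding to matroid bases *)

Definition gmatroid (N : finType) (B : pred {set N}) :=
  forall (X Y : {set N}) (i : N), B X -> B Y -> i \in X :\: Y ->
    B (X :\ i) /\ B (i |: Y) \/
    exists2 j, j \in Y :\: X & B (j |: (X :\ i)) /\ B ((i |: Y) :\ j).

Section Padding.

Variables (N : finType) (B : pred {set N}).
Hypothesis gmB : gmatroid B.

(** While some [i] lies in [X :\: Y], the exchange axiom turns [Y] into a member that is no smaller,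
    nearer to [X], and has no new element outside [X]. Once [X \subset Y], exchanging from [Y] to
    [X] can only add an element to [X]. *)
Lemma gmatroid_augment X Y : B X -> B Y -> #|X| < #|Y| ->
  exists2 j, j \in Y :\: X & B (j |: X).
Proof.
have [k] := ubnP #|X :\: Y|; elim: k => // k IHk in Y *; rewrite ltnS => leXk.
move=> BX BY ltXY.
have [XY0 | [i iXY]] := set_0Vmem (X :\: Y).
  have [j jYX] : exists j, j \in Y :\: X.
    apply/set0Pn; rewrite -cards_eq0 -lt0n; have := cardsID X Y.
    have := subset_leq_card (subsetIr Y X); lia.
  case: (gmB BY BX jYX) => [[_ BjX]|[i]]; first by exists j.
  by rewrite XY0 inE.
have [iY iX] : i \notin Y /\ i \in X by apply/andP; rewrite -in_setD.
suff [Y' [BY' leYY' ltXY' sY']] : exists Y' : {set N}, [/\ B Y', #|Y| <= #|Y'|,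
    #|X :\: Y'| < #|X :\: Y| & Y' :\: X \subset Y :\: X].
  have [||j jY' BjX] := IHk Y' _ BX BY'; [lia | lia |].
  by exists j => //; apply: subsetP jY'.
have [[_ BY']|[j]] := gmB BX BY iXY.
  exists (i |: Y); split=> //; first by rewrite subset_leq_card ?subsetUr.
    apply: proper_card; apply/properP; split; first by rewrite setDS ?subsetUr.
    by exists i; rewrite // !inE eqxx.
  by apply/subsetP=> x; rewrite !inE; case: eqVneq => [->|]; rewrite ?iX.
rewrite inE => /andP[jX jY] [_ BY']; exists ((i |: Y) :\ j); split=> //.
- have := cardsD1 j (i |: Y); rewrite cardsU1 iY !inE jY orbT; lia.
- apply: proper_card; apply/properP; split.
    apply/subsetP=> x; rewrite !inE; case: eqVneq => [->|_]; first by rewrite (negPf jX) andbF.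
    by case: (x == i); case: (x \in Y); rewrite ?orbT ?orbF ?andbT ?andbF.
  exists i; rewrite // !inE eqxx iX /= andbT negbK andbT.
  by apply: contraNneq jX => <-.
- by apply/subsetP=> x; rewrite !inE; case: (eqVneq x i) => [->|]; rewrite ?iX //=;
    case: (x == j); rewrite ?andbF.
Qed.

(** The right copies are dummies, present only to give all sets the same cardinality. *)
Definition padded (S : {set N + N}) : bool := B (inl @^-1: S) && (#|S| == #|N|).

Lemma card_sum_set (S : {set N + N}) : #|S| = #|inl @^-1: S| + #|inr @^-1: S|.
Proof.
rewrite -!sum1_card big_sumType /=.
by congr (_ + _); apply: eq_bigl => x; rewrite inE.
Qed.

(** A swap keeps the cardinality, so only the real part needs care. If the exchange axiom of [B]
    does not supply [j], a dummy of [Y] outside [X] will do; if there is none, counting makes the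
    real part of [Y] larger than that of [X :\ i], and augmentation applies. *)
Lemma padded_exchange : basis_exchange padded.
Proof.
move=> X Y i /andP[BX /eqP cX] /andP[BY /eqP cY]; rewrite inE => /andP[iY iX].
have cXs := card_sum_set X; have cYs := card_sum_set Y.
have exch j : j \in Y :\: X -> B (inl @^-1: (j |: (X :\ i))) ->
    exists2 j, j \in Y :\: X & padded (j |: (X :\ i)).
  move=> jYX Bj; exists j; rewrite // /padded Bj -cX /=.
  have jX : j \notin X by move: jYX; rewrite inE => /andP[].
  by rewrite cardsU1 !inE (negPf jX) andbF (cardsD1 i X) iX.
have no_dummy : inr @^-1: Y \subset inr @^-1: X \/
    exists d, inr d \in Y :\: X.
  case: (boolP (_ \subset _)) => [|/subsetPn[d]]; [by left | rewrite !inE => dY dX].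
  by right; exists d; rewrite inE dX.
have inlr d (Z : {set N + N}) : inl @^-1: (inr d |: Z) = inl @^-1: Z.
  by apply/setP=> x; rewrite !inE.
have inlU j (Z : {set N + N}) : inl @^-1: (inl j |: Z) = j |: inl @^-1: Z.
  by apply/setP=> x; rewrite !inE.
case: i iX iY exch => [a|d] iX iY exch.
- have inlD : inl @^-1: (X :\ inl a) = (inl @^-1: X) :\ a.
    by apply/setP=> x; rewrite !inE.
  have aXY : a \in inl @^-1: X :\: inl @^-1: Y by rewrite !inE iX iY.
  have [[BXa _]|[j jYX [Bj _]]] := gmB BX BY aXY; last first.
    by apply: (exch (inl j)); [move: jYX; rewrite !inE | rewrite inlU inlD].
  have [sYX|[d dYX]] := no_dummy; last by apply: (exch (inr d)); rewrite // inlr inlD.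
  have [|j] := gmatroid_augment BXa BY.
    have := subset_leq_card sYX; have := cardsD1 a (inl @^-1: X).
    by rewrite inE iX; lia.
  rewrite !inE negb_and negbK => /andP[/orP[/eqP ->|jX] jY Bj].
    by rewrite jY in iY.
  by apply: (exch (inl j)); rewrite ?inE ?jX // inlU inlD.
- have inlD : inl @^-1: (X :\ inr d) = inl @^-1: X.
    by apply/setP=> x; rewrite !inE.
  have [sYX|[d' dYX]] := no_dummy; last by apply: (exch (inr d')); rewrite // inlr inlD.
  have [|j] := gmatroid_augment BX BY.
    suff: #|inr @^-1: Y| < #|inr @^-1: X| by lia.
    by apply/proper_card/properP; split=> //; exists d; rewrite inE.
  by rewrite !inE => jYX Bj; apply: (exch (inl j)); rewrite ?inE // inlU inlD.
Qed.

Lemma padded_extension X : B X -> exists2 S, padded S & inl @^-1: S = X.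
Proof.
(* Adding one dummy for each element missing from [X] gives exactly [#|N|] elements. *)
move=> BX; pose S := [set s : N + N | match s with inl x => x \in X | inr x => x \notin X end].
have SX : inl @^-1: S = X by apply/setP=> x; rewrite !inE.
exists S; rewrite // /padded SX BX card_sum_set SX /= -(cardsC X).
by apply/eqP; congr (_ + _); apply: eq_card => x; rewrite !inE.
Qed.

Lemma gmatroid_multiple_exchange X Y (I : {set N}) : B X -> B Y -> I \subset X :\: Y ->
  exists J : {set N}, [/\ J \subset Y :\: X,
    B ((X :\: I) :|: J) & B ((Y :\: J) :|: I)].
Proof.
move=> /padded_extension[X' pX' <-] /padded_extension[Y' pY' <-] sI.
have card_padded S : padded S -> #|S| = #|N| by case/andP=> _ /eqP.
have inlK : inl @^-1: ((@inl N N) @: I) = I.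
  by apply/setP=> x; rewrite inE mem_imset //; apply: inl_inj.
have [|J [sJ]] := basis_multiple_exchange card_padded padded_exchange
    (I := inl @: I) pX' pY'.
  by apply/subsetP=> _ /imsetP[x xI ->]; have := subsetP sI x xI; rewrite !inE.
rewrite /padded !preimsetU !preimsetD inlK => /andP[B1 _] /andP[B2 _].
by exists (inl @^-1: J); split=> //; rewrite -preimsetD preimsetS.
Qed.

End Padding.

(** * Maximizers of an M-natural-concave function *)

Section Argmax.
Local Open Scope ring_scope.

Variables (R : realDomainType) (N : finType) (f : {set N} -> option R).

Definition argmaxb : pred {set N} := fun X => [forall Z, ele (f Z) (f X)].

Lemma argmaxP X : reflect (in_argmax f X) (argmaxb X).
Proof. exact: forallP. Qed.

Lemma ele_emax (a b c : option R) : ele a (emax b c) -> ele a b || ele a c.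
Proof. by rewrite /emax; case: ifP => _ ->; rewrite ?orbT. Qed.

(** The finite lower bound [Some x] excludes the value [None] of an empty maximum. *)
Lemma ele_bigmax (I : finType) (P : pred I) (F : I -> option R) (x : R) :
  ele (Some x) (\big[@emax R/None]_(i | P i) F i) -> exists2 i, P i & ele (Some x) (F i).
Proof.
elim/big_rec: _ => // i y Pi IH /ele_emax/orP[]; last exact: IH.
by exists i.
Qed.

(** Neither [f A] nor [f C] exceeds the maximum, so a sum of at least twice the maximum forces
    equality in both; finiteness of [f X] permits the cancellation. *)
Lemma ele_eadd_argmax X A C : in_argmax f X -> f X != None ->
  ele (eadd (f X) (f X)) (eadd (f A) (f C)) -> argmaxb A /\ argmaxb C.
Proof.
move=> maxX; have := maxX A; have := maxX C.
case fX: (f X) => [x|//]; case fA: (f A) => [a|//]; case fC: (f C) => [c|//] /=.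
move=> lecx leax _ lexac.
have eac : a = x /\ c = x.
  split; apply/eqP; rewrite eq_le ?leax ?lecx /=.
    by rewrite -(lerD2r x) (le_trans lexac) ?lerD2l.
  by rewrite -(lerD2l x) (le_trans lexac) ?lerD2r.
by split; apply/forallP=> Z; rewrite ?fA ?fC ?(eac.1) ?(eac.2) -fX; apply: maxX.
Qed.

Lemma argmax_gmatroid : Mnat_concave f -> gmatroid argmaxb.
Proof.
case=> /set0Pn[Z0]; rewrite inE => domZ0 conc X Y i /argmaxP maxX /argmaxP maxY iXY.
(* The maximum is finite because [dom f] is nonempty. *)
have domX : f X != None by have := maxX Z0; case: (f Z0) domZ0 (f X) => // z _ [].
have fXY : f Y = f X.
  have := maxX Y; have := maxY X; case: (f X) (f Y) => [x|] [y|] //= lexy leyx.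
  by congr Some; apply/eqP; rewrite eq_le lexy leyx.
have := conc X Y i iXY; rewrite fXY => /ele_emax/orP[]; first by left; apply: ele_eadd_argmax maxX _ _.
case fX: (f X) domX => [x|//] domX /ele_bigmax[j jYX]; rewrite -fX in domX * => le_j.
right; exists j => //; apply: ele_eadd_argmax maxX domX _.
by move: le_j; rewrite fX.
Qed.

End Argmax.

Theorem theorem2 (R : realDomainType) (N : finType)
    (f : {set N} -> option R) (X Y I : {set N}) :
  Mnat_concave f -> in_argmax f X -> in_argmax f Y -> I \subset X :\: Y ->
  exists J : {set N}, J \subset Y :\: X /\
    in_argmax f ((X :\: I) :|: J) /\ in_argmax f ((Y :\: J) :|: I).
Proof.
move=> /argmax_gmatroid gm /argmaxP maxX /argmaxP maxY sI.
have [J [sJ /argmaxP max1 /argmaxP max2]] := gmatroid_multiple_exchange gm maxX maxY sI.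
by exists J.
Qed.
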